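(* Let $k \geq 0$ and let $F$ be a $k$-edge graph with $\gamma(F) = 1$, i.e. $F$ has a vertex adjacent to all other vertices of $F$. Let $m \ge 0$ and let $G$ be a connected $m$-edge graph such that $(G,F)$ is not special, i.e. $G$ is not a copy of $F$, and it is not the case that $F$ is a copy of $P_3$ (equivalently $K_{1,2}$) and $G$ is a copy of the $6$-cycle $C_6$. Then \[\iota(G,F) \leq \left\lfloor \frac{m+1}{k+2} \right\rfloor.\] Moreover, equality holds if $G$ is an $(m,F)$-special graph.
   Context: All graphs are finite and simple. For a graph $G$ and $D \subseteq V(G)$, $N[D]$ denotes the closed neighbourhood $\bigcup_{v\in D} N[v]$ of $D$ in $G$, and $G - N[D]$ is the graph obtained by deleting the vertices of $N[D]$. A graph is an $F$-copy if it is isomorphic to $F$. A set $D \subseteq V(G)$ is an $F$-isolating set of $G$ if $G - N[D]$ contains no subgraph that is an $F$-copy; $\iota(G,F)$ is the size of a smallest $F$-isolating set of $G$. $\gamma(F)$ is the domination number of $F$. $P_3$ is the path on $3$ vertices and $C_6$ the cycle on $6$ vertices. $(m,F)$-special graph (for $F$ a connected $k$-edge graph, with $F \simeq K_1$ if $k=0$): write $m+1 = q(k+2)+r$ with integers $q \ge 0$ and $0 \le r \le k+1$. If $q = 0$, an $(m,F)$-special graph is any connected $m$-edge graph. If $q \geq 1$: take distinct vertices $v_1,\dots,v_q$ and copies $F_1,\dots,F_q$ of $F$ such that $V(F_1),\dots,V(F_q)$ and $\{v_1,\dots,v_q\}$ are pairwise disjoint; for each $i\in[q]$ pick $w_i \in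 V(F_i)$ and let $G_i$ be the graph with vertex set $\{v_i\}\cup V(F_i)$ and edge set $\{v_iw_i\}\cup E(F_i)$. Let $T$ be any tree with vertex set $\{v_1,\dots,v_q\}$, and let $T'$ be any connected $r$-edge graph with $V(T') \cap \bigcup_{i=1}^q V(G_i) = \{v_q\}$. Then the graph $G$ with $V(G) = V(T') \cup \bigcup_{i=1}^q V(G_i)$ and $E(G) = E(T)\cup E(T')\cup \bigcup_{i=1}^q E(G_i)$ is an $(m,F)$-special graph. (Every such graph is a connected $m$-edge graph.) *)

(* Defs.v *)
From mathcomp Require Import all_boot.
Set Implicit Arguments. Unset Strict Implicit. Unset Printing Implicit Defensive.

Record sgraph := SGraph {
  svert :> finType;
  sadj : rel svert;
  sadj_sym : symmetric sadj;
  sadj_irr : irreflexive sadj }.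

Definition edges_rel (T : finType) (e : rel T) : {set {set T}} :=
  [set [set p.1; p.2] | p in [pred p : T * T | e p.1 p.2]].
Definition nedges_rel (T : finType) (e : rel T) : nat := #|edges_rel e|.
Definition nedges (G : sgraph) : nat := nedges_rel (@sadj G).

Definition conn_on (T : finType) (A : {set T}) (e : rel T) : Prop :=
  A != set0 /\ {in A &, forall x y, connect e x y}.
Definition connected (G : sgraph) : Prop := conn_on [set: G] (@sadj G).

Definition acyclic (T : finType) (e : rel T) : Prop :=
  forall c : seq T, 2 < size c -> uniq c -> ~~ cycle e c.

Definition is_tree (T : finType) (e : rel T) : Prop :=
  [/\ symmetric e, irreflexive e, conn_on [set: T] e & acyclic e].

Definition iso_rel (V W : finType) (e : rel V) (e' : rel W) : Prop :=
  exists f : V -> W, bijective f /\ forall x y, e' (f x) (f y) = e x y.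
Definition iso (G H : sgraph) : Prop := iso_rel (@sadj G) (@sadj H).

(* P_3 : path 0 - 1 - 2 ;  C_6 : cycle 0 - 1 - ... - 5 - 0 *)
Definition P3rel : rel 'I_3 := fun i j => (val i == 1) != (val j == 1).
Definition C6rel : rel 'I_6 :=
  fun i j => (val j == (val i).+1 %% 6) || (val i == (val j).+1 %% 6).

Definition closed_nbh (G : sgraph) (D : {set G}) : {set G} :=
  [set x | (x \in D) || [exists y in D, sadj y x]].

Definition dominating (G : sgraph) (D : {set G}) : bool :=
  closed_nbh D == [set: G].
Definition gamma (G : sgraph) : nat :=
  \big[minn/#|G|]_(D : {set G} | dominating D) #|D|.

Definition has_F_copy_outside (G F : sgraph) (D : {set G}) : bool :=
  [exists f : {ffun F -> G}, [&& injectiveb f,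
    [forall a, f a \notin closed_nbh D] &
    [forall a, forall b, sadj a b ==> sadj (f a) (f b)]]].

Definition F_isolating (G F : sgraph) (D : {set G}) : bool :=
  ~~ has_F_copy_outside F D.

Definition iotaF (G F : sgraph) : nat :=
  \big[minn/#|G|]_(D : {set G} | F_isolating F D) #|D|.

(* G is (isomorphic to) an (m,F)-special graph, the construction being
   realised inside G: v i = v_(i+1), phi i = the copy F_(i+1), w i = w_(i+1),
   t = tree T (on indices), W = V(T'), t' = E(T'). *)
Definition special (m : nat) (F G : sgraph) : Prop :=
  let k := nedges F in
  let q := m.+1 %/ (k + 2) in
  let r := m.+1 %% (k + 2) in
  if q == 0 then connected G /\ nedges G = m
  else exists (v : 'I_q -> G) (phi : 'I_q -> F -> G) (w : 'I_q -> F)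
              (t : rel 'I_q) (W : {set G}) (t' : rel G),
    let inGi x i := (x = v i \/ exists a, x = phi i a) in
    [/\ [/\ injective v, (forall i, injective (phi i)),
            (forall i j a, v i <> phi j a) &
            (forall i j a b, i <> j -> phi i a <> phi j b)],
        is_tree t,
        [/\ symmetric t', irreflexive t',
            (forall x y, t' x y -> x \in W /\ y \in W),
            conn_on W t' & nedges_rel t' = r],
        (forall x, (x \in W /\ exists i, inGi x i) <->
                   exists i : 'I_q, val i = q.-1 /\ x = v i) /\
        (forall x : G, x \in W \/ exists i, inGi x i) &
        (forall x y : G, sadj x y <->
           [\/ exists i j, [/\ t i j, x = v i & y = v j],
               t' x y,
               exists i, (x = v i /\ y = phi i (w i)) \/
                         (x = phi i (w i) /\ y = v i) |
               exists i a b, [/\ sadj a b, x = phi i a & y = phi i b]])].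

(* Main.v *)
Require Import Defs.
From mathcomp Require Import all_boot.
From Stdlib Require Import Classical.
From mathcomp Require Import zify.
Set Implicit Arguments. Unset Strict Implicit. Unset Printing Implicit Defensive.

(** Induction on a vertex set [S] inducing a connected subgraph.  Remove [Z]
    from [S].  A component [H] of the rest is joined to [Z] by [adjn H Z >= 1]
    edges, so if it is neither [F] nor the exceptional [C_6], then the
    [ed H + adjn H Z] edges meeting [H] pay [k + 2] for each vertex chosen for
    [H]; the same is true of a special [H] with at least two edges to [Z].  A
    special component hanging from [x] by a single edge [xy] becomes cheap once
    [x] is chosen, because [x] dominates [y].  So assume there is none, and take
    an [F]-copy with centre [v].  If [N[v]] spans more than [k] edges, choose
    [v].  If this never happens, every [F]-copy is exactly some [N[c]], with
    [k] edges, and [N[v]] pays for [v] up to one missing edge.  If a component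
    of [S - N[v]] is a copy of [F], remove it and choose its centre; when only
    two copies of [F] joined by two edges remain, a single vertex is enough
    unless [S] is [C_6].  Otherwise, a component whose payment is not tight
    provides the missing edge; if all are tight, choose a neighbour [x] of [v]
    joined to a vertex [y] outside [N[v]]: deleting [y] from its component
    loses divisibility by [k + 2], hence saves a whole vertex. *)

(** * Edge counts and components *)

Section EdgeCounts.
Context {G : sgraph}.
Implicit Types (x y : G) (A B C H R S Z : {set G}).

(* Ordered pairs: an edge inside [A :&: B] counts twice. *)
Definition adjn A B : nat := \sum_(x in A) \sum_(y in B) sadj x y.
Definition ed A : nat := (adjn A A)./2.

Lemma adjnC A B : adjn A B = adjn B A.
Proof.
rewrite /adjn exchange_big /=; apply: eq_bigr => y _; apply: eq_bigr => x _.
by rewrite sadj_sym.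
Qed.

Lemma adjn_split A S B : A \subset S -> adjn S B = adjn A B + adjn (S :\: A) B.
Proof. by move=> /setIidPr AS; rewrite /adjn (big_setID A) /= AS. Qed.

Lemma adjn_splitr A S B : A \subset S -> adjn B S = adjn B A + adjn B (S :\: A).
Proof. by move=> AS; rewrite !(adjnC B) (adjn_split _ AS). Qed.

Lemma adjnSl A A' B : A \subset A' -> adjn A B <= adjn A' B.
Proof. by move=> /(adjn_split B) ->; apply: leq_addr. Qed.

Lemma adjnSr A B B' : B \subset B' -> adjn A B <= adjn A B'.
Proof. by rewrite !(adjnC A); apply: adjnSl. Qed.

Lemma adjn0 A : adjn set0 A = 0.
Proof. by rewrite /adjn big_set0. Qed.

Lemma adjn1 x y : adjn [set x] [set y] = sadj x y.
Proof. by rewrite /adjn !big_set1. Qed.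

(** Deleting a vertex [x] removes its row and its column, which have equal sums, and the diagonal
    entry is zero. Hence the halving in [ed] loses nothing. *)
Lemma adjn_even A : adjn A A = (ed A).*2.
Proof.
suff: ~~ odd (adjn A A) by move=> /even_halfK <-.
have [n] := ubnP #|A|; elim: n => // n IH in A *.
have [->|[x xA]] := set_0Vmem A; first by rewrite adjn0.
rewrite (cardsD1 x) xA add1n ltnS => /IH ev.
have sx : [set x] \subset A by rewrite sub1set.
rewrite (adjn_split _ sx) !(adjn_splitr _ sx) adjn1 sadj_irr add0n.
by rewrite (adjnC (A :\ x)) addnA addnn oddD odd_double.
Qed.

Lemma ed_split A S : A \subset S -> ed S = ed A + ed (S :\: A) + adjn A (S :\: A).
Proof.
move=> AS; apply: double_inj; rewrite !doubleD -!adjn_even.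
rewrite (adjn_split _ AS) !(adjn_splitr _ AS) (adjnC (S :\: A)) -addnn; lia.
Qed.

Lemma edS A S : A \subset S -> ed A <= ed S.
Proof. by move=> /ed_split ->; lia. Qed.

Lemma ed1 x : ed [set x] = 0.
Proof. by rewrite /ed adjn1 sadj_irr. Qed.

Lemma adjn_gt0P A B :
  reflect (exists x y, [/\ x \in A, y \in B & sadj x y]) (0 < adjn A B).
Proof.
apply: (iffP idP) => [|[x [y [xA yB xy]]]]; last first.
  by rewrite /adjn (bigD1 x) //= (bigD1 y) //= xy.
rewrite lt0n /adjn sum_nat_eq0 => /forall_inPn [x xA].
rewrite sum_nat_eq0 => /forall_inPn [y yB].
by rewrite eqb0 negbK => xy; exists x, y.
Qed.

Lemma adjn_eq0 A B x y : adjn A B = 0 -> x \in A -> y \in B -> sadj x y = false.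
Proof.
move=> h xA yB; apply/negP => xy; suff: 0 < adjn A B by rewrite h.
by apply/adjn_gt0P; exists x, y.
Qed.

(** The pair [x], [y] already exhausts the count. This identifies the unique edge by which a
    component hangs. *)
Lemma adjn_eq1 A B x y x' y' : adjn A B = 1 -> x \in A -> y \in B -> sadj x y ->
  x' \in A -> y' \in B -> sadj x' y' -> x' = x /\ y' = y.
Proof.
move=> h xA yB xy xA' yB' xy'.
have sA : [set x] \subset A by rewrite sub1set.
have sB : [set y] \subset B by rewrite sub1set.
move: h; rewrite (adjn_split _ sA) (adjn_splitr _ sB) adjn1 xy => h.
have ex : x' = x.
  apply/eqP/negPn/negP => nx.
  suff: 0 < adjn (A :\ x) B by lia.
  by apply/adjn_gt0P; exists x', y'; rewrite !inE nx.
split=> //; apply/eqP/negPn/negP => ny; rewrite {}ex in xy'.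
suff: 0 < adjn [set x] (B :\ y) by lia.
by apply/adjn_gt0P; exists x, y'; rewrite !inE ny eqxx.
Qed.

(* Connectivity by cuts: no paths are needed to find components. *)
Definition conn S : Prop :=
  S != set0 /\ forall A, A \subset S -> A != set0 -> A != S -> 0 < adjn A (S :\: A).

Definition component R H : Prop := [/\ conn H, H \subset R & adjn H (R :\: H) = 0].

(** Take a nonempty subset of minimum size with no edge to the rest of [R]; a cut of it without
    edges would give a smaller one. *)
Lemma component_ex R : R != set0 -> exists H, component R H.
Proof.
move=> R0; pose P H := [&& H \subset R, H != set0 & adjn H (R :\: H) == 0].
have PR : P R by rewrite /P subxx R0 setDv adjnC adjn0.
have [H /and3P[HR H0 /eqP cl] min] := arg_minnP (fun H => #|H|) PR.
exists H; split=> //; split=> // A AH A0 AnH; rewrite lt0n; apply/negP => /eqP c.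
have AR := subset_trans AH HR.
suff /min : P A.
  by rewrite leqNgt proper_card // properEneq AnH.
rewrite /P AR A0 /=; have sb : H :\: A \subset R :\: A by apply: setSD.
rewrite (adjn_splitr _ sb) c add0n -leqn0 -cl.
apply: leq_trans (adjnSl _ AH) _; apply: adjnSr.
by apply/subsetP => z; rewrite !inE; case: (z \in A); case: (z \in H).
Qed.

Lemma component_sub R R' H : R' \subset R -> adjn R' (R :\: R') = 0 -> component R' H -> component R H.
Proof.
move=> sR c [cH HR' c']; split=> //; first exact: subset_trans sR.
have sb : R' :\: H \subset R :\: H by apply: setSD.
rewrite (adjn_splitr _ sb) c' add0n; apply/eqP; rewrite -leqn0 -c.
apply: leq_trans (adjnSl _ HR') _; apply: adjnSr.
apply/subsetP => z; rewrite !inE => /and3P[h zH ->]; rewrite andbT.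
by apply: contra h => ->; rewrite zH.
Qed.

(** Allows components to be peeled off one at a time. *)
Lemma component_compl R H H' : component R H -> component (R :\: H) H' -> component R H'.
Proof.
case=> _ HR c; apply: component_sub; first exact: subsetDl.
have -> : R :\: (R :\: H) = H by rewrite setDDr setDv set0U; apply/setIidPr.
by rewrite adjnC.
Qed.

Lemma component_adjn S Z H : component (S :\: Z) H -> Z \subset S -> adjn H (S :\: H) = adjn H Z.
Proof.
move=> [_ HR c] ZS.
have sb : Z \subset S :\: H.
  apply/subsetP => z zZ; rewrite inE (subsetP ZS) // andbT.
  by apply/negP => /(subsetP HR); rewrite inE zZ.
rewrite (adjn_splitr _ sb); suff -> : S :\: H :\: Z = S :\: Z :\: H by rewrite c addn0.
by rewrite !setDDl setUC.
Qed.

Lemma component_adjn_gt0 S Z H :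
  conn S -> component (S :\: Z) H -> Z \subset S -> Z != set0 -> 0 < adjn H Z.
Proof.
move=> [_ cS] cH ZS Z0; rewrite -(component_adjn cH ZS); case: cH => -[H0 _] HR _.
apply: cS => //; first by apply: subset_trans HR (subsetDl _ _).
apply: contra Z0 => /eqP eHS; rewrite -subset0; apply/subsetP => z zZ.
have := subsetP ZS _ zZ; rewrite -eHS => /(subsetP HR).
by rewrite inE zZ.
Qed.

(** A side of a cut that avoids [Z] has no edge to the component [H], so the edges leaving it in [S]
    stay in [S :\: H]. If neither side avoids [Z], the cut splits the connected set [Z]. *)
Lemma conn_compl S Z H :
  conn S -> component (S :\: Z) H -> Z \subset S -> conn Z -> conn (S :\: H).
Proof.
move=> [S0 cS] cH ZS [Z0 cZ]; have [[H0 _] HR cl] := cH.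
have dZ z : z \in Z -> z \notin H.
  by move=> zZ; apply/negP => /(subsetP HR); rewrite inE zZ.
have ZT : Z \subset S :\: H.
  by apply/subsetP => z zZ; rewrite inE dZ // (subsetP ZS).
have key B : B \subset S :\: H -> B != set0 -> B :&: Z = set0 ->
    0 < adjn B (S :\: H :\: B).
  move=> BT B0 BZ.
  have BS : B \subset S by apply: subset_trans BT (subsetDl _ _).
  have BnS : B != S.
    apply: contra Z0 => /eqP eB; rewrite -subset0 -BZ eB; apply/subsetP => z zZ.
    by rewrite inE zZ (subsetP ZS).
  have := cS B BS B0 BnS.
  have sb : S :\: H :\: B \subset S :\: B by apply/setSD/subsetDl.
  rewrite (adjn_splitr _ sb); suff -> : adjn B (S :\: B :\: (S :\: H :\: B)) = 0.
    by rewrite addn0.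
  apply/eqP; rewrite -leqn0 -cl adjnC.
  apply: (@leq_trans (adjn H B)).
    apply: adjnSl; apply/subsetP => z; rewrite !inE.
    by case: (z \in S); case: (z \in H); case: (z \in B).
  apply: adjnSr; apply/subsetP => z zB; have := subsetP BT _ zB.
  rewrite !inE => /andP[-> ->]; rewrite andbT /=.
  by apply/negP => zZ; have := in_set0 z; rewrite -BZ inE zB zZ.
split; first by case/set0Pn: Z0 => z zZ; apply/set0Pn; exists z; apply: (subsetP ZT).
move=> A AT A0 AnT.
have [/key|AZ0] := eqVneq (A :&: Z) set0; first exact.
have [AZ|AnZ] := eqVneq (A :&: Z) Z; last first.
  apply: leq_trans (cZ _ (subsetIr _ _) AZ0 AnZ) _.
  apply: leq_trans (adjnSl _ (subsetIl _ _)) (adjnSr _ _).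
  apply/subsetP => z; rewrite !inE => /andP[h zZ].
  by rewrite dZ // (subsetP ZS) // zZ !andbT in h *.
have e1 : S :\: H :\: (S :\: H :\: A) = A.
  by rewrite setDDr setDv set0U; apply/setIidPr.
have := @key (S :\: H :\: A); rewrite e1 adjnC; apply; first exact: subsetDl.
- apply: contra AnT => /eqP h; rewrite eqEsubset AT /=.
  by rewrite -setD_eq0 h.
- apply/setP => z; rewrite !inE; apply/negP => /andP[/andP[zA _] zZ].
  by move: zZ; rewrite -AZ inE (negPf zA).
Qed.

Lemma conn_add1 H x y : conn H -> y \in H -> sadj x y -> conn (x |: H).
Proof.
move=> [H0 cH] yH xy; have [xH|xH] := boolP (x \in H).
  by have -> : x |: H = H by apply/setUidPr; rewrite sub1set.
have key A : A \subset x |: H -> A != set0 -> x \notin A -> 0 < adjn A ((x |: H) :\: A).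
  move=> AS A0 xA.
  have AH : A \subset H.
    apply/subsetP => z zA; have := subsetP AS _ zA; rewrite !inE => /orP[] // /eqP zx.
    by rewrite -zx zA in xA.
  have [->|AnH] := eqVneq A H; last first.
    by apply: leq_trans (cH _ AH A0 AnH) (adjnSr _ _); apply/setSD/subsetUr.
  by apply/adjn_gt0P; exists y, x; rewrite yH !inE eqxx xH sadj_sym xy.
split=> [|A AS A0 AnS]; first by apply/set0Pn; exists x; rewrite !inE eqxx.
have [xA|] := boolP (x \in A); last exact: key.
have := key ((x |: H) :\: A); rewrite setDDr setDv set0U (setIidPr AS) adjnC.
apply; first exact: subsetDl.
  by apply: contra AnS; rewrite setD_eq0 eqEsubset AS.
by rewrite !inE xA.
Qed.

Lemma ed_add1 H x : x \notin H -> ed (x |: H) = ed H + adjn H [set x].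
Proof.
move=> xH; have sx : [set x] \subset x |: H by apply: subsetUl.
by rewrite (ed_split sx) ed1 setU1K // adjnC.
Qed.

End EdgeCounts.

(** * Antipodes and neighbourhoods on the $6$-cycle *)

Definition opp6 (i : 'I_6) : 'I_6 := Ordinal (ltn_pmod (i + 3) (isT : 0 < 6)).

(** Two antipodal vertices dominate the cycle, so two vertices isolate it; the four alternatives
    also drive the case analysis once one vertex of the cycle is dominated from outside. *)
Lemma C6_opp (i j : 'I_6) :
  [|| j == i, C6rel i j, j == opp6 i | C6rel (opp6 i) j].
Proof.
by case: i j => [[|[|[|[|[|[|i]]]]]] Hi] // [[|[|[|[|[|[|j]]]]]] Hj].
Qed.

Lemma C6_nbh (j : 'I_6) : #|[set i | (i == j) || C6rel j i]| = 3.
Proof.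
rewrite -sum1_card big_mkcond /= !big_ord_recl big_ord0 !inE.
by case: j => [[|[|[|[|[|[|j]]]]]] Hj].
Qed.

(** * Copies of [F] *)

Lemma sum_setT (I : finType) (E : I -> nat) : \sum_(x in [set: I]) E x = \sum_x E x.
Proof. by apply: eq_bigl => x; rewrite inE. Qed.

Section Copies.
Context {F G : sgraph} {c0 : F} {k : nat}.
Hypothesis c0_dom : forall a, a != c0 -> sadj c0 a.
Hypothesis ed_F : ed [set: F] = k.
Implicit Types (f : F -> G) (v x y : G) (D H R S T Z : {set G}).

Definition copy S f : Prop :=
  [/\ injective f, forall a, f a \in S & forall a b, sadj a b -> sadj (f a) (f b)].
Definition nb S v : {set G} := [set u in S | (u == v) || sadj v u].
Definition hits f D : Prop := exists a, f a \in closed_nbh D.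
(** Only the copies are confined to [S]; [D] and its neighbourhoods live in all of [G], so sets
    found for different parts of [G] can simply be united. *)
Definition isol S D : Prop := forall f, copy S f -> hits f D.
(* [S] is spanned by a copy of [F] and has no further edges. *)
Definition is_F S : Prop := [/\ #|S| = #|F|, ed S = k & exists f, copy S f].
(** The conditions [#|F| = 3] and [k = 2] encode that [F] is a copy of $P_3$: with a dominating
    vertex, two edges on three vertices form a star. *)
Definition is_C6 S : Prop :=
  [/\ #|F| = 3, k = 2 & exists h : 'I_6 -> G,
    [/\ injective h, S = h @: [set: 'I_6] & forall i j, sadj (h i) (h j) = C6rel i j]].
Definition bad S : Prop := is_F S \/ is_C6 S.

Lemma copy_sub S T f : copy S f -> (forall a, f a \in T) -> copy T f.
Proof. by case=> inj _ hom fT; split. Qed.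

Lemma hitsS f D D' : D \subset D' -> hits f D -> hits f D'.
Proof.
move=> /subsetP sub [a]; rewrite inE => h; exists a; rewrite inE.
case/orP: h => [/sub->//|/exists_inP[y /sub yD ya]].
by apply/orP; right; apply/exists_inP; exists y.
Qed.

Lemma nbh1 v u : (u \in closed_nbh [set v]) = (u == v) || sadj v u.
Proof.
rewrite inE in_set1; congr orb; apply/exists_inP/idP => [[y /set1P->] //|h].
by exists v; rewrite ?set11.
Qed.

Lemma hits1 f v a : (f a == v) || sadj v (f a) -> hits f [set v].
Proof. by move=> h; exists a; rewrite nbh1. Qed.

(** This is where $\gamma(F) = 1$ enters: a copy lies in the closed neighbourhood of its centre
    [f c0]. *)
Lemma copy_nb S f a : copy S f -> f a \in nb S (f c0).
Proof.
case=> _ fS hom; rewrite inE fS /=.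
by have [->|/c0_dom/hom->] := eqVneq a c0; rewrite ?eqxx ?orbT.
Qed.

Lemma card_img S f : copy S f -> #|f @: [set: F]| = #|F|.
Proof. by case=> inj _ _; rewrite card_imset // cardsT. Qed.

Lemma img_nb S f : copy S f -> f @: [set: F] \subset nb S (f c0).
Proof. by move=> cf; apply/subsetP => z /imsetP[a _ ->]; apply: copy_nb. Qed.

Lemma nb_sub S v : nb S v \subset S.
Proof. by apply/subsetP => z; rewrite inE => /andP[]. Qed.

Lemma adjn_img S f : copy S f ->
  adjn (f @: [set: F]) (f @: [set: F]) = \sum_a \sum_b sadj (f a) (f b).
Proof.
case=> inj _ _; rewrite /adjn big_imset /=; last by move=> ? ? _ _; apply: inj.
rewrite sum_setT; apply: eq_bigr => a _; rewrite big_imset /=; last by move=> ? ? _ _; apply: inj.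
by rewrite sum_setT.
Qed.

Lemma adjn_T : adjn [set: F] [set: F] = \sum_(a : F) \sum_(b : F) sadj a b.
Proof. by rewrite /adjn sum_setT; apply: eq_bigr => a _; rewrite sum_setT. Qed.

Lemma ed_img S f : copy S f -> k <= ed (f @: [set: F]).
Proof.
move=> cf; have [_ _ hom] := cf; rewrite -ed_F; apply: half_leq.
rewrite (adjn_img cf) adjn_T; apply: leq_sum => a _; apply: leq_sum => b _.
by case: (boolP (sadj a b)) => // /hom ->.
Qed.

Lemma ed_nb S f : copy S f -> k <= ed (nb S (f c0)).
Proof. by move=> cf; apply: leq_trans (ed_img cf) (edS (img_nb cf)). Qed.

(** A vertex of the neighbourhood outside the image would add its edge to [f c0] to the [k] edges of
    the image. *)
Lemma nb_img S f : copy S f -> ed (nb S (f c0)) <= k -> nb S (f c0) = f @: [set: F].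
Proof.
move=> cf le; have sub := img_nb cf; apply/eqP; rewrite eqEsubset sub andbT.
apply/negPn/negP => /subsetPn[z zN zI].
have [/eqP ezc|nz] := boolP (z == f c0).
  by rewrite ezc imset_f ?inE in zI.
have az : sadj (f c0) z by move: zN; rewrite inE (negPf nz) /= => /andP[].
have := ed_split sub; have := ed_img cf.
have : 0 < adjn (f @: [set: F]) (nb S (f c0) :\: f @: [set: F]).
  by apply/adjn_gt0P; exists (f c0), z; split=> //; rewrite ?imset_f ?inE // zI; rewrite inE in zN.
by lia.
Qed.

Lemma is_F_img S f : is_F S -> copy S f -> S = f @: [set: F].
Proof.
move=> [cS _ _] cf; apply/esym/eqP; rewrite eqEcard (card_img cf) cS leqnn andbT.
by apply: subset_trans (img_nb cf) (nb_sub _ _).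
Qed.

Lemma is_F_center S : is_F S -> exists2 h, h \in S & forall u, u \in S -> (u == h) || sadj h u.
Proof.
move=> iF; have [_ _ [f cf]] := iF; exists (f c0); first by case: cf.
move=> u; rewrite {1}(is_F_img iF cf) => /(subsetP (img_nb cf)).
by rewrite inE => /andP[].
Qed.

Lemma isol_C6 S : is_C6 S -> exists2 D : {set G}, #|D| = 2 & isol S D.
Proof.
case=> _ _ [h [inj eS adj]]; exists [set h ord0; h (opp6 ord0)].
  by rewrite cards2 (inj_eq inj).
move=> f [_ fS _]; exists c0; move: (fS c0); rewrite eS => /imsetP[i _ ->].
rewrite !inE !(inj_eq inj).
case/or4P: (C6_opp ord0 i) => [-> //|c|->|c]; rewrite ?orbT //.
  by apply/orP; right; apply/exists_inP; exists (h ord0); rewrite ?adj ?set21.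
by apply/orP; right; apply/exists_inP; exists (h (opp6 ord0)); rewrite ?adj ?set22.
Qed.

Lemma ed_C6 S : is_C6 S -> ed S = 6.
Proof.
case=> _ _ [h [inj -> adj]].
rewrite /ed /adjn big_imset /=; last by move=> ? ? _ _; apply: inj.
rewrite sum_setT (eq_bigr (fun i : 'I_6 => 2)) ?sum_nat_const ?card_ord // => i _.
rewrite big_imset /=; last by move=> ? ? _ _; apply: inj.
rewrite sum_setT (eq_bigr (fun j => C6rel i j : nat)) => [|j _]; last by rewrite adj.
rewrite !big_ord_recl big_ord0.
by case: i => [[|[|[|[|[|[|i]]]]]] Hi].
Qed.

Lemma nb_C6 S j (h : 'I_6 -> G) : injective h -> S = h @: [set: 'I_6] ->
  (forall i j, sadj (h i) (h j) = C6rel i j) -> #|nb S (h j)| = 3.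
Proof.
move=> inj -> adj; apply: etrans (C6_nbh j); rewrite -(card_imset _ inj).
apply: eq_card => z.
rewrite inE; apply/andP/imsetP => [[/imsetP[i _ ->]]|[i]].
  by rewrite (inj_eq inj) adj => c; exists i; rewrite ?inE.
by rewrite inE => c ->; rewrite imset_f ?inE // (inj_eq inj) adj.
Qed.

(* Sorting copies by their centre makes coverings of disjoint regions add up,
   even for copies that leave the region of their centre. *)
Definition cov S z R D : Prop :=
  forall f, copy S f -> f c0 \in R -> hits f (z :|: D).

(** A copy that meets [Z] is hit by [z]. One that avoids [Z] and has its centre in [R] lies in [R],
    since its vertices are neighbours of its centre. *)
Lemma isol_cov S Z z R D : Z \subset closed_nbh z ->
  (forall u v, u \in R -> v \in S -> sadj u v -> v \in R :|: Z) ->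
  isol R D -> cov S z R D.
Proof.
move=> Zz nR iR f cf cR; have [inj fS hom] := cf.
have [/existsP[a aZ]|/existsPn nZ] := boolP [exists a, f a \in Z].
  by apply: (@hitsS _ z); [apply: subsetUl|exists a; apply: (subsetP Zz)].
apply: (@hitsS _ D); first exact: subsetUr.
apply: iR; apply: (copy_sub cf) => a; have [->//|nac] := eqVneq a c0.
have := nR _ _ cR (fS a) (hom _ _ (c0_dom nac)).
by rewrite inE => /orP[|aZ] //; have := nZ a; rewrite aZ.
Qed.

Lemma cov_comps S z Z R :
  (forall H, component R H ->
     exists2 D : {set G}, #|D| * (k + 2) <= ed H + adjn H Z & cov S z H D) ->
  exists2 D : {set G}, #|D| * (k + 2) <= ed R + adjn R Z & cov S z R D.
Proof.
clear ed_F; have [n] := ubnP #|R|; elim: n => // n IH in R * => ltn hyp.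
have [->|R0] := eqVneq R set0.
  by exists set0; rewrite ?cards0 // => f _; rewrite inE.
have [H cH] := component_ex R0; have [D1 le1 c1] := hyp H cH; have [[H0 _] HR cl] := cH.
have [||D2 le2 c2] := IH (R :\: H).
- rewrite ltnS in ltn; apply: leq_trans ltn; apply: proper_card.
  rewrite properEneq subsetDl andbT; apply: contra H0 => /eqP e.
  rewrite -subset0; apply/subsetP => z0 zH; have := subsetP HR _ zH.
  by rewrite -e inE zH.
- by move=> H' /(component_compl cH); apply: hyp.
exists (D1 :|: D2).
  have [leU _] := leq_card_setU D1 D2; have := leq_mul leU (leqnn (k + 2)).
  rewrite (ed_split HR) cl (adjn_split _ HR) mulnDl; lia.
move=> f cf cR; have [cH'|cH'] := boolP (f c0 \in H).
  by apply: hitsS (c1 f cf cH'); apply/setUS/subsetUl.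
apply: hitsS (c2 f cf _); first by apply/setUS/subsetUr.
by rewrite inE cH'.
Qed.

Lemma component_nb S Z H u v : component (S :\: Z) H -> u \in H -> v \in S -> sadj u v -> v \in H :|: Z.
Proof.
case=> _ _ cl uH vS uv; rewrite inE; apply/negPn/negP; rewrite negb_or => /andP[vH vZ].
by have := adjn_eq0 cl uH (y := v); rewrite !inE vH vZ vS uv => /(_ isT).
Qed.

Lemma star3 : #|F| = 3 -> k = 2 ->
  (exists a b : F, a != b /\ [set: F] :\ c0 = [set a; b]) /\
  forall p q : F, sadj p q = ((p == c0) != (q == c0)).
Proof.
move=> F3 k2; have sc : [set c0] \subset [set: F] by apply: subsetT.
have card2 : #|[set: F] :\ c0| = 2.
  by have := cardsD1 c0 [set: F]; rewrite cardsT inE F3; lia.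
split; first by have /eqP/cards2P[a [b [nab eab]]] := card2; exists a, b.
have star : adjn [set c0] ([set: F] :\ c0) = 2.
  rewrite /adjn big_set1 -card2 -sum1_card; apply: eq_bigr => a.
  by rewrite !inE andbT => /c0_dom ->.
have := ed_split sc; rewrite ed_F ed1 star k2 add0n => e0.
have {e0} e0 : adjn ([set: F] :\ c0) ([set: F] :\ c0) = 0.
  by rewrite adjn_even; lia.
move=> p q; have [->|pc] := eqVneq p c0; have [->|qc] := eqVneq q c0.
- by rewrite sadj_irr.
- by rewrite c0_dom.
- by rewrite sadj_sym c0_dom.
- by rewrite (adjn_eq0 e0) // !inE andbT.
Qed.

Lemma P3_copy S t u w : #|F| = 3 -> k = 2 -> u != w -> sadj t u -> sadj t w ->
  t \in S -> u \in S -> w \in S -> exists2 f, copy S f & f c0 = t.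
Proof.
move=> F3 k2 uw tu tw tS uS wS; have [[a [b [nab eab]]] adjF] := star3 F3 k2.
pose f (x : F) := if x == c0 then t else if x == a then u else w.
have sp (x : F) : x != c0 -> (x == a) || (x == b).
  by move=> xc; rewrite -in_set2 -eab !inE xc.
have nt x : sadj t x -> (t == x) = false.
  by move=> tx; apply/negP => /eqP e; rewrite e sadj_irr in tx.
exists f; last by rewrite /f eqxx.
split=> [x y|x|x y].
- have [->|xc] := eqVneq x c0; have [->|yc] := eqVneq y c0 => //;
    rewrite /f ?eqxx ?(negPf xc) ?(negPf yc).
  + by case: ifP => _ /eqP; rewrite nt.
  + by case: ifP => _ /esym/eqP; rewrite nt.
  + have := sp _ xc; have := sp _ yc.
    have [->|_] := eqVneq x a; have [->|_] := eqVneq y a => //=.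
    * by move=> _ _ /eqP; rewrite (negPf uw).
    * by move=> _ _ /esym/eqP; rewrite (negPf uw).
    * by move=> /eqP-> /eqP->.
- by rewrite /f; do 2 case: ifP => // _.
- rewrite adjF /f; case: (x == c0); case: (y == c0) => //= _; [|rewrite sadj_sym].
    by case: ifP.
  by case: ifP.
Qed.

End Copies.

(** * The inductive step *)

(** As [a] and [a'] differ, [a] and the rest of [A] carry exactly one edge each, and the case of a
    single edge applies to both. *)
Lemma adjn_eq2 (G : sgraph) (A B : {set G}) a b a' b' p q : adjn A B = 2 ->
  a \in A -> b \in B -> sadj a b -> a' \in A -> b' \in B -> sadj a' b' -> a' != a ->
  p \in A -> q \in B -> sadj p q -> p = a /\ q = b \/ p = a' /\ q = b'.
Proof.
move=> e2 aA bB ab aA' bB' ab' na pA qB pq.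
have sA : [set a] \subset A by rewrite sub1set.
have := e2; rewrite (adjn_split _ sA).
have : 0 < adjn [set a] B by apply/adjn_gt0P; exists a, b; rewrite set11.
have : 0 < adjn (A :\ a) B by apply/adjn_gt0P; exists a', b'; rewrite !inE na.
move=> g1 g2 e; have [e1 e1'] : adjn [set a] B = 1 /\ adjn (A :\ a) B = 1.
  by clear -g1 g2 e; lia.
have [epa|npa] := eqVneq p a; [left|right].
  by apply: (adjn_eq1 e1); rewrite // ?set11 ?epa ?set11 // -epa.
by apply: (adjn_eq1 e1'); rewrite // !inE ?na ?npa.
Qed.

Section Step.
Context {F G : sgraph} {c0 : F} {k : nat}.
Hypothesis c0_dom : forall a, a != c0 -> sadj c0 a.
Hypothesis ed_F : ed [set: F] = k.
Implicit Types (f g : F -> G) (u v x y : G) (D H R T Z : {set G}).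

Local Notation bad := (@bad F G k).
Local Notation is_F := (@is_F F G k).
Local Notation is_C6 := (@is_C6 F G k).
Local Notation isol := (@isol F G).
Local Notation cov := (@cov F G c0).

(** The bound $|D| \leq \lfloor (e+1)/(k+2) \rfloor$, with $e$ the number of edges inside [S],
    cleared of the division. *)
Definition solved S : Prop :=
  exists2 D : {set G}, #|D| * (k + 2) <= ed S + 1 & isol S D.

Context {S : {set G}}.
Hypothesis conn_S : conn S.
Hypothesis good_S : ~ bad S.
Hypothesis IH : forall T, T \proper S -> conn T -> ~ bad T -> solved T.

(* Once [x] is chosen, the component saves [k + 1] of its edges, which together
   with the spare unit of the bound is the price of [x]. *)
Lemma deficit_cov x H :
  component (S :\ x) H -> bad H -> adjn H [set x] = 1 ->
  exists2 D : {set G}, #|D| * (k + 2) + k.+1 <= ed H + 1 & cov S [set x] H D.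
Proof.
move=> cH bH a1.
have /adjn_gt0P[y [x' [yH /set1P ex yx]]] : 0 < adjn H [set x] by rewrite a1.
rewrite {}ex in yx.
have away f : copy S f -> f c0 \in H -> hits f [set x] \/ copy H f /\ forall a, f a != y.
  move=> cf cfH; have [inj fS hom] := cf.
  have [/existsP[a ha]|/existsPn nh] := boolP [exists a, (f a == x) || sadj x (f a)].
    by left; apply: hits1 ha.
  right; split=> [|a]; last first.
    by apply: contra (nh a) => /eqP->; rewrite sadj_sym yx orbT.
  apply: (copy_sub cf) => a; have [->//|nac] := eqVneq a c0.
  have := component_nb cH cfH (fS a) (hom _ _ (c0_dom nac)).
  by rewrite !inE => /orP[//|e]; have := nh a; rewrite e.
case: bH => [iF|iC].
  exists set0; first by rewrite cards0; have [_ -> _] := iF; lia.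
  move=> f cf cfH; rewrite setU0; case: (away f cf cfH) => [//|[cfH' ny]].
  have := yH; rewrite (is_F_img c0_dom iF cfH') => /imsetP[a _ e].
  by have := ny a; rewrite e eqxx.
have eH := ed_C6 iC; case: iC => F3 k2 [h [inj sH adj]].
have /imsetP[i _ ey] : y \in h @: [set: 'I_6] by rewrite -sH.
(* Here [k = 2] and [1 * 4 + 3 = 6 + 1]. The antipode of [y] dominates all but [y] and its two
   neighbours, and a copy centred at one of these three contains [y]. *)
exists [set h (opp6 i)]; first by rewrite cards1; lia.
move=> f cf cfH; case: (away f cf cfH) => [hf|[cfH' ny]].
  by apply: hitsS hf; apply: subsetUl.
have := cfH; rewrite {1}sH => /imsetP[j _ ej].
case/or4P: (C6_opp i j) => [/eqP eij|c|/eqP e|c].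
- by have := ny c0; rewrite ej ey eij eqxx.
- have sub := img_nb c0_dom cfH'.
  have e : f @: [set: F] = nb H (f c0).
    by apply/eqP; rewrite eqEcard sub (card_img cfH') ej (nb_C6 _ inj sH adj) F3.
  have : y \in nb H (f c0) by rewrite inE yH sadj_sym ej ey adj c orbT.
  by rewrite -e => /imsetP[a _ e']; have := ny a; rewrite e' eqxx.
- apply: (@hitsS _ _ _ [set h (opp6 i)]); first exact: subsetUr.
  by apply: (hits1 (a := c0)); rewrite ej e eqxx.
- apply: (@hitsS _ _ _ [set h (opp6 i)]); first exact: subsetUr.
  by apply: (hits1 (a := c0)); rewrite ej adj c orbT.
Qed.

(** For good [H], an edge to [Z] covers the [+ 1] of the inductive bound. For bad [H] there are two
    such edges: a copy of [F] pays [k + 2] for its centre, and the cycle pays [8 = 6 + 2] for two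
    antipodes. *)
Lemma budget Z H : H \proper S -> conn H -> 0 < adjn H Z ->
  (bad H -> adjn H Z != 1) ->
  exists2 D : {set G}, #|D| * (k + 2) <= ed H + adjn H Z & isol H D.
Proof.
move=> pH cH a0 nd; have [bH|nbH] := classic (bad H); last first.
  by have [D le iD] := IH pH cH nbH; exists D => //; lia.
have a1 := nd bH; case: bH => [iF|iC].
  have [h hH hc] := is_F_center c0_dom iF; exists [set h].
    by rewrite cards1; have [_ -> _] := iF; lia.
  by move=> f [_ fH _]; apply: (hits1 (a := c0)); apply: hc.
have [D D2 iD] := isol_C6 (c0 := c0) iC; exists D => //.
by rewrite (ed_C6 iC) D2; have [_ -> _] := iC; lia.
Qed.

Lemma isol_cov_comp Z z H D :
  component (S :\: Z) H -> Z \subset closed_nbh z -> isol H D -> cov S z H D.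
Proof.
by move=> cH Zz; apply: (isol_cov c0_dom Zz) => u v; apply: component_nb.
Qed.

Lemma component_proper Z H : Z \subset S -> Z != set0 -> component (S :\: Z) H -> H \proper S.
Proof.
move=> ZS /set0Pn[z zZ] [_ HR _]; apply/properP; split.
  by apply: subset_trans HR (subsetDl _ _).
by exists z; [apply: (subsetP ZS)|apply/negP => /(subsetP HR); rewrite inE zZ].
Qed.

Lemma card_set1U x D : #|x |: D| <= 1 + #|D|.
Proof. by rewrite cardsU1; case: (x \in D). Qed.

Lemma deficit_case x H : x \in S ->
  component (S :\ x) H -> bad H -> adjn H [set x] = 1 -> solved S.
Proof.
move=> xS cH bH a1; have [D1 le1 c1] := deficit_cov cH bH a1.
have sx : [set x] \subset S by rewrite sub1set.
have x0 : [set x] != set0 by apply/set0Pn; exists x; rewrite set11.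
have xx : [set x] \subset closed_nbh [set x] by rewrite sub1set nbh1 eqxx.
have [|D2 le2 c2] := @cov_comps _ _ c0 k S [set x] [set x] (S :\ x :\: H).
  move=> H' /(component_compl cH) cH'.
  (* Further components of the same kind as [H] save even more than is asked of them here. *)
  have [[bH' a1']|nd] := classic (bad H' /\ adjn H' [set x] = 1).
    by have [D le cD] := deficit_cov cH' bH' a1'; exists D => //; lia.
  have [||||D le iD] := @budget [set x] H'.
  - exact: component_proper cH'.
  - by case: cH'.
  - exact: component_adjn_gt0 cH' _ _.
  - by move=> bH'; apply/eqP => a1'; apply: nd.
  - by exists D => //; apply: (isol_cov_comp cH').
(* Of the price [k + 2] of [x], [H] leaves [k] edges unspent, the edge from [H] to [x] gives one,
   and the [+ 1] of the bound gives the last. *)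
exists (x |: (D1 :|: D2)).
  have [leU _] := leq_card_setU D1 D2.
  have := leq_mul (leq_trans (card_set1U x (D1 :|: D2)) (leq_add (leqnn 1) leU)) (leqnn (k + 2)).
  have [_ HR cl] := cH.
  have := ed_split sx; have := ed_split HR; rewrite cl ed1 (adjnC [set x]) (adjn_split _ HR) a1.
  lia.
move=> f cf; have [_ fS _] := cf; have [cx|ncx] := eqVneq (f c0) x.
  apply: (@hitsS _ _ _ [set x]); first by apply: subsetUl.
  by apply: (hits1 (a := c0)); rewrite cx eqxx.
have [cfH|ncH] := boolP (f c0 \in H).
  by apply: hitsS (c1 f cf cfH); apply/setUS/subsetUl.
have := c2 f cf; rewrite !inE ncx ncH fS => /(_ isT).
by apply: hitsS; apply/setUS/subsetUr.
Qed.

Hypothesis no_deficit : forall x H, x \in S ->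
  component (S :\ x) H -> bad H -> adjn H [set x] != 1.

(** If a single edge left [H], deleting its outer end [x] would make [H] a component of [S :\ x],
    which [no_deficit] excludes. *)
Lemma bad_adjn H : conn H -> H \subset S -> bad H -> adjn H (S :\: H) != 1.
Proof.
move=> cH HS bH; apply/eqP => a1.
have /adjn_gt0P[y [x [yH xR yx]]] : 0 < adjn H (S :\: H) by rewrite a1.
have [xS xH] : x \in S /\ x \notin H by move: xR; rewrite inE => /andP[].
have sx : [set x] \subset S :\: H by rewrite sub1set.
have g : 0 < adjn H [set x] by apply/adjn_gt0P; exists y, x; rewrite set11.
move: a1; rewrite (adjn_splitr _ sx) => a1.
have : adjn H [set x] != 1.
  apply: no_deficit => //; split=> //; first by rewrite subsetD1 HS.
  by rewrite setDDl setUC -setDDl; lia.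
by case/eqP; lia.
Qed.

Lemma budget_comp Z z H : Z \subset S -> Z != set0 -> Z \subset closed_nbh z ->
  component (S :\: Z) H ->
  exists2 D : {set G}, #|D| * (k + 2) <= ed H + adjn H Z & cov S z H D.
Proof.
move=> ZS Z0 Zz cH; have [cnH _ _] := cH.
have pH := component_proper ZS Z0 cH.
have [|bH|D le iD] := budget pH cnH (Z := Z).
- exact: component_adjn_gt0 cH _ _.
- by rewrite -(component_adjn cH ZS); apply: bad_adjn => //; apply: proper_sub.
- by exists D => //; apply: (isol_cov_comp cH).
Qed.

Lemma nb_dom v : nb S v \subset closed_nbh [set v].
Proof. by apply/subsetP => u; rewrite nbh1 inE => /andP[]. Qed.

Lemma nb_v v : v \in S -> v \in nb S v.
Proof. by move=> vS; rewrite inE vS eqxx. Qed.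

Lemma nb_hit f v D : copy S f -> f c0 \in nb S v -> hits f (v |: D).
Proof.
move=> cf; rewrite inE => /andP[_ h]; apply: (@hitsS _ _ _ [set v]).
  exact: subsetUl.
by apply: (hits1 (a := c0)).
Qed.

(** The at least [k + 1] edges inside [Z], with the spare unit of the bound, pay for [v]. *)
Lemma dense_case f : copy S f -> k < ed (nb S (f c0)) -> solved S.
Proof.
move=> cf; set v := f c0; set Z := nb S v => lt; have [_ fS _] := cf.
have ZS : Z \subset S := nb_sub _ _.
have Z0 : Z != set0 by apply/set0Pn; exists v; apply: (nb_v (fS c0)).
have [H|D le cD] := @cov_comps _ _ c0 k S [set v] Z (S :\: Z).
  by apply: budget_comp => //; apply: nb_dom.
exists (v |: D).
  have := leq_mul (card_set1U v D) (leqnn (k + 2)).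
  by have := ed_split ZS; rewrite adjnC; lia.
move=> g cg; have [cgZ|ncg] := boolP (g c0 \in Z); first exact: nb_hit.
by apply: cD => //; case: cg => _ gS _; rewrite inE ncg gS.
Qed.

(** * Sparse case: every copy is the whole closed neighbourhood of its centre *)

Hypothesis sparse : forall f, copy S f -> ed (nb S (f c0)) <= k.

Lemma nb_card f : copy S f -> #|nb S (f c0)| = #|F|.
Proof. by move=> cf; rewrite (nb_img c0_dom ed_F cf (sparse cf)) (card_img cf). Qed.

Lemma ed_nbE f : copy S f -> ed (nb S (f c0)) = k.
Proof. by move=> cf; apply/eqP; rewrite eqn_leq sparse //= ed_nb. Qed.

(** Some [t] on the cycle has a neighbour outside it. With its two neighbours on the cycle, [t] is
    the centre of a $P_3$, yet its closed neighbourhood has at least four vertices. *)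
Lemma no_C6 T : T \proper S -> ~ is_C6 T.
Proof.
move=> pT iC; have [TS Tn] := andP pT; have [F3 k2 [h [inj eT adj]]] := iC.
have T0 : T != set0 by apply/set0Pn; exists (h ord0); rewrite eT imset_f ?inE.
have TnS : T != S by apply: contra Tn => /eqP->.
have [_ cS] := conn_S; have /adjn_gt0P[t [u [tT uR tu]]] := cS T TS T0 TnS.
have := tT; rewrite eT => /imsetP[i _ et].
have [i1 [i2 [n12 c1 c2]]] : exists i1 i2 : 'I_6, [/\ i1 != i2, C6rel i i1 & C6rel i i2].
  exists (Ordinal (ltn_pmod (i + 1) (isT : 0 < 6))), (Ordinal (ltn_pmod (i + 5) (isT : 0 < 6))).
  by case: (i) => [[|[|[|[|[|[|j]]]]]] Hj].
have hS j : h j \in S by apply: (subsetP TS); rewrite eT imset_f ?inE.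
have [||||||f cf fc] := P3_copy c0_dom ed_F (S := S) (t := t) (u := h i1) (w := h i2) F3 k2.
- by rewrite (inj_eq inj).
- by rewrite et adj.
- by rewrite et adj.
- by rewrite et hS.
- exact: hS.
- exact: hS.
have := nb_card cf; rewrite fc F3.
have : u |: nb T t \subset nb S t.
  apply/subsetP => z; rewrite !inE => /orP[/eqP->|/andP[/(subsetP TS) -> ->] //].
  by rewrite tu orbT andbT; move: uR; rewrite inE => /andP[].
move=> /subset_leq_card; rewrite cardsU1 et (nb_C6 _ inj eT adj) -et inE.
by move: uR; rewrite inE => /andP[/negPf-> _] le e; rewrite e in le.
Qed.

Lemma nb_conn v : v \in S -> conn (nb S v).
Proof.
move=> vS; split; first by apply/set0Pn; exists v; apply: nb_v.
move=> A AZ A0 AnZ; apply/adjn_gt0P.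
have vz z : z \in nb S v -> z != v -> sadj v z.
  by rewrite inE => /andP[_ /orP[->|]].
have [vA|vA] := boolP (v \in A).
  have /subsetPn[z zZ zA] : ~~ (nb S v \subset A).
    by apply: contra AnZ => h; rewrite eqEsubset AZ.
  exists v, z; rewrite !in_setD zA zZ; split=> //; apply: vz => //.
  by apply: contra zA => /eqP->.
have /set0Pn[z zA] := A0; exists z, v; rewrite in_setD vA nb_v //; split=> //.
rewrite sadj_sym; apply: vz; first exact: (subsetP AZ).
by apply: contra vA => /eqP<-.
Qed.

(** * Two copies of [F] joined by exactly two edges *)

Section TwoCopies.
Context {f0 : F -> G} {H : {set G}}.
Let v := f0 c0.
Let Z := nb S v.
Hypothesis copy_f0 : copy S f0.
Hypothesis HS : H \subset S.
Hypothesis ZE : Z = S :\: H.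
Hypothesis is_F_H : is_F H.
Hypothesis two_edges : adjn H Z = 2.

(* A copy missed by [x] must be centred at the end [c] of the second edge
   [c x'], and consists of [x'] and all of [H] but [y]. *)
Lemma missed_copy x y : x \in Z -> y \in H -> sadj y x -> ~ isol S [set x] ->
  exists x' c, [/\ [/\ x' \in Z, c \in H & sadj c x'], x' != x /\ c != y,
    ~~ sadj c y /\ ~~ sadj x x', (forall u, u \in H -> u != y -> u != c -> sadj c u) &
    adjn [set y] (H :\ y) = 1].
Proof.
move=> xZ yH yx nis.
have [g [cg ng]] : exists g, copy S g /\ ~ hits g [set x].
  by apply: NNPP => no; case: nis => g cg; apply: NNPP => ng; case: no; exists g.
pose c := g c0; have nbE := nb_img c0_dom ed_F cg (sparse cg).
have [_ gS _] := cg; have cS : c \in S := gS c0.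
have vS : v \in S by have [_ f0S _] := copy_f0; apply: f0S.
have far u : u \in nb S c -> ~~ ((u == x) || sadj x u).
  by rewrite nbE => /imsetP[a _ ->]; apply/negP => h; apply: ng; apply: hits1 h.
have xS : x \in S := subsetP (nb_sub _ _) _ xZ.
(* A centre in [Z] would have [v] in its closed neighbourhood, hence in the copy, and [x] dominates
   [v]. *)
have cH : c \in H.
  apply/negPn/negP => ncH.
  have cZ : c \in Z by rewrite ZE inE ncH.
  have vc : v \in nb S c.
    by move: cZ; rewrite !inE vS /= sadj_sym eq_sym => /andP[].
  by have := far _ vc; move: xZ; rewrite inE sadj_sym eq_sym => /andP[_ ->].
have yS := subsetP HS _ yH.
have xy : sadj x y by rewrite sadj_sym.
have ync : y \notin nb S c by apply/negP => /far; rewrite xy orbT.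
have cy : c != y by apply: contra ync => /eqP <-; apply: nb_v.
have ncy : ~~ sadj c y by apply: contra ync; rewrite inE yS => ->; rewrite orbT.
have [cH' edH _] := is_F_H; have cN := nb_card cg.
have /subsetPn[x' xN xH] : ~~ (nb S c \subset H).
  apply/negP => sub; have e : nb S c = H by apply/eqP; rewrite eqEcard sub cN cH' leqnn.
  by rewrite e yH in ync.
have xZ' : x' \in Z by rewrite ZE inE xH; apply: (subsetP (nb_sub _ _) _ xN).
have cx' : sadj c x'.
  by move: xN; rewrite inE => /andP[_ /orP[/eqP e|//]]; rewrite e cH in xH.
have := far _ xN; rewrite negb_or => /andP[nx nxx].
have edges p q := adjn_eq2 two_edges yH xZ yx cH xZ' cx' cy (p := p) (q := q).
(* The only edge from [c] to [Z] is [c x'], and [y] is excluded; the cardinality of a copy then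
   leaves no choice. *)
have eN : nb S c = x' |: (H :\ y).
  apply/eqP; rewrite eqEcard cN; apply/andP; split.
    apply/subsetP => z zN; rewrite !inE.
    have zS := subsetP (nb_sub _ _) _ zN.
    have [zH|zH] := boolP (z \in H).
      by apply/orP; right; rewrite andbT; apply: contra ync => /eqP<-.
    have cz : sadj c z.
      by move: zN; rewrite inE => /andP[_ /orP[/eqP e|//]]; rewrite e cH in zH.
    have [||//|[e _]|[_ ->]] := edges c z; rewrite ?eqxx // ?ZE ?inE ?zH //.
    by rewrite e eqxx in cy.
  by rewrite cardsU1 !inE (negPf xH) andbF /= -cH' (cardsD1 y H) yH.
exists x', c; split=> //.
- move=> u uH uy uc; have : u \in nb S c by rewrite eN !inE uy uH orbT.
  by rewrite inE (negPf uc) => /andP[].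
have sy : [set y] \subset H by rewrite sub1set.
have xHy : x' \notin H :\ y by rewrite !inE (negPf xH) andbF.
(* Both [H] and [nb S c] span [k] edges, and the latter arises by exchanging [y] for [x']. As [x']
   has one neighbour in [H :\ y], so has [y]. *)
have := ed_nbE cg; rewrite -/c eN (ed_add1 xHy) -edH (ed_split sy) ed1.
suff -> : adjn (H :\ y) [set x'] = 1 by clear; lia.
apply/eqP; rewrite eqn_leq; apply/andP; split; last first.
  by apply/adjn_gt0P; exists c, x'; rewrite !inE cy cH eqxx.
have := two_edges; rewrite (adjn_split _ sy).
have : 0 < adjn [set y] Z by apply/adjn_gt0P; exists y, x; rewrite set11.
have : adjn (H :\ y) [set x'] <= adjn (H :\ y) Z by apply: adjnSr; rewrite sub1set.
by clear; lia.
Qed.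

(** Otherwise the ends in [Z] of both edges miss a copy, and these two missed copies force [S] to be
    the $6$-cycle. *)
Lemma two_copies : exists d, isol S [set d].
Proof.
apply: NNPP => no; have nis x : ~ isol S [set x] by move=> h; apply: no; exists x.
have /adjn_gt0P[y [x [yH xZ yx]]] : 0 < adjn H Z by rewrite two_edges.
have [x' [c [[xZ' cH cx'] [nx cy] [ncy nxx] cdom ay]]] := missed_copy xZ yH yx (nis x).
(* The same with the two edges exchanged; the copy missed by [x'] must be centred at [y]. *)
have [x2 [c2 [[xZ2 cH2 cx2] [nx2 cy2] _ ydom ac]]] := missed_copy xZ' cH cx' (nis x').
have edges p q := adjn_eq2 two_edges yH xZ yx cH xZ' cx' cy (p := p) (q := q).
have e1 : c2 = y.
  by case: (edges c2 x2 cH2 xZ2 cx2) => -[e _] //; rewrite e eqxx in cy2.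
rewrite {}e1 {cH2 cy2 xZ2 cx2 nx2 x2 c2} in ydom.
have [h hH hdom] := is_F_center c0_dom is_F_H.
have hy : h != y.
  apply/eqP => e; have := hdom c cH.
  by rewrite e (negPf cy) sadj_sym (negPf ncy).
have hc : h != c.
  apply/eqP => e; have := hdom y yH.
  by rewrite e eq_sym (negPf cy) (negPf ncy).
have yh : sadj y h by rewrite ydom.
have chh : sadj c h by rewrite cdom.
(* The vertex [y] is adjacent to all of [H] except [c] and itself, but has only one neighbour in
   [H], namely [h]. *)
have eH : H = [set y; h; c].
  apply/setP => u; rewrite !inE; apply/idP/orP => [uH|[/orP[]|] /eqP->//].
  have [uy|uy] := eqVneq u y; first by left.
  have [uc|uc] := eqVneq u c; first by right.
  have [_ ->] : y = y /\ u = h; last by left; rewrite eqxx orbT.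
  by apply: (adjn_eq1 ay); rewrite ?set11 ?yh ?ydom // !inE ?hy ?uy.
have [cardH edH _] := is_F_H.
have card3 a1 a2 a3 : a1 != a2 -> a1 != a3 -> a2 != a3 -> #|[set a1; a2; a3]| = 3.
  move=> n12 n13 n23; rewrite -setUA cardsU1 cards2 n23 !inE.
  by rewrite (negPf n12) (negPf n13).
have F3 : #|F| = 3 by rewrite -cardH eH card3 // eq_sym.
have k2 : k = 2.
  have sy : [set y] \subset H by rewrite sub1set.
  have eHy : H :\ y = [set h; c].
    rewrite eH; apply/setP => u; rewrite !inE; have [->|//] := eqVneq u y.
    by rewrite eq_sym (negPf hy) eq_sym (negPf cy).
  rewrite -edH (ed_split sy) ay ed1 eHy ed_add1 ?inE // ed1 adjn1.
  by rewrite chh.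
have vS : v \in S by have [_ f0S _] := copy_f0; apply: f0S.
have vnH u : u \in H -> (v == u) = false /\ sadj v u = false.
  move=> uH; suff : u \notin Z by rewrite inE (subsetP HS) //= negb_or eq_sym => /andP[/negPf-> /negPf->].
  by rewrite ZE inE uH.
have vZ : v \in Z by apply: nb_v.
have vx : v != x.
  by apply/eqP => e; have [_] := vnH y yH; rewrite e sadj_sym yx.
have vx' : v != x'.
  by apply/eqP => e; have [_] := vnH c cH; rewrite e sadj_sym cx'.
have avx : sadj v x by move: xZ; rewrite inE eq_sym (negPf vx) => /andP[].
have avx' : sadj v x' by move: xZ'; rewrite inE eq_sym (negPf vx') => /andP[].
have eZ : Z = [set v; x; x'].
  apply/esym/eqP; rewrite eqEcard card3 // 1?eq_sym // (nb_card copy_f0) F3 leqnn andbT.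
  by apply/subsetP => u /setUP[/set2P[]|/set1P] ->.
(* The vertices in cyclic order; what remains is to exclude the chords. *)
pose s := [:: v; x; y; h; c; x'].
have ZH z u : z \in Z -> u \in H -> (z == u) = false.
  by move=> zZ uH; apply/negP => /eqP e; move: zZ; rewrite ZE inE e uH.
have us : uniq s.
  rewrite /s /= !inE !negb_or vx vx' hc (eq_sym x x') nx (eq_sym y h) hy (eq_sym y c) cy.
  by rewrite !(ZH v) // !(ZH x) // !(eq_sym _ x') !(ZH x').
have eS : S = Z :|: H.
  apply/setP => u; rewrite ZE in_setU in_setD; have [/(subsetP HS)->//|] := boolP (u \in H).
  by rewrite orbF.
have nxh : sadj x h = false.
  apply/negP => xh; have [||//|[e _]|[e _]] := edges h x; rewrite // 1?sadj_sym //.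
    by rewrite e eqxx in hy.
  by rewrite e eqxx in hc.
have nxh' : sadj x' h = false.
  apply/negP => xh; have [||//|[e _]|[e _]] := edges h x'; rewrite // 1?sadj_sym //.
    by rewrite e eqxx in hy.
  by rewrite e eqxx in hc.
have nxc : sadj x c = false.
  apply/negP => xh; have [||//|[e _]|[_ e]] := edges c x; rewrite // 1?sadj_sym //.
    by rewrite e eqxx in cy.
  by rewrite e eqxx in nx.
have nxy : sadj x' y = false.
  apply/negP => xh; have [||//|[_ e]|[e _]] := edges y x'; rewrite // 1?sadj_sym //.
    by rewrite e eqxx in nx.
  by rewrite e eqxx in cy.
apply: good_S; right; split=> //; exists (fun i : 'I_6 => nth v s i); split.
- by move=> i j /eqP; rewrite nth_uniq // => /eqP/val_inj.
- apply/esym/eqP; rewrite eqEcard; apply/andP; split.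
    apply/subsetP => z /imsetP[i _ ->]; rewrite eS.
    have : nth v s i \in s by rewrite mem_nth.
    rewrite in_setU; move: (nth v s i) => u; rewrite !(in_cons, in_nil) orbF.
    by case/or4P => [/eqP->|/eqP->|/eqP->|/or3P[]/eqP->];
      rewrite ?vZ ?xZ ?xZ' ?yH ?hH ?cH ?orbT.
  rewrite card_imset; last by move=> i j /eqP; rewrite nth_uniq // => /eqP/val_inj.
  rewrite cardsT card_ord eS; have [leU _] := leq_card_setU Z H; apply: leq_trans leU _.
  by rewrite (nb_card copy_f0) cardH F3.
- have [vy1 vy2] := vnH y yH; have [vh1 vh2] := vnH h hH; have [vc1 vc2] := vnH c cH.
  have sy u w b : sadj u w = b -> sadj w u = b by rewrite sadj_sym.
  case=> [[|[|[|[|[|[|i]]]]]] Hi] // [[|[|[|[|[|[|j]]]]]] Hj] //=;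
    rewrite ?sadj_irr // ?avx ?avx' ?yx ?yh ?chh ?cx' ?vy2 ?vh2 ?vc2
      ?nxh ?nxh' ?nxc ?nxy ?(negPf ncy) ?(negPf nxx) //; apply: sy;
    by rewrite ?sadj_irr // ?avx ?avx' ?yx ?yh ?chh ?cx' ?vy2 ?vh2 ?vc2
      ?nxh ?nxh' ?nxc ?nxy ?(negPf ncy) ?(negPf nxx).
Qed.

End TwoCopies.

Lemma copy_component_case f H :
  copy S f -> component (S :\: nb S (f c0)) H -> is_F H -> solved S.
Proof.
move=> cf cH iF; set v := f c0; set Z := nb S v.
have [_ fS _] := cf; have vS : v \in S := fS c0.
have [cnH HR _] := cH; have [H0 _] := cnH.
have HS : H \subset S := subset_trans HR (subsetDl _ _).
have ZS : Z \subset S := nb_sub _ _.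
have Z0 : Z != set0 by apply/set0Pn; exists v; apply: nb_v.
have pT : S :\: H \proper S.
  apply/properP; split; first exact: subsetDl.
  have /set0Pn[z zH] := H0; exists z; first exact: (subsetP HS).
  by rewrite inE zH.
have cT := conn_compl conn_S cH ZS (nb_conn vS).
have a2 : 1 < adjn H (S :\: H).
  have := bad_adjn cnH HS (or_introl iF); rewrite (component_adjn cH ZS).
  by have := component_adjn_gt0 conn_S cH ZS Z0; case: (adjn H Z) => [|[|]].
have [h hH hdom] := is_F_center c0_dom iF; have [cardH edH _] := iF.
have eS := ed_split HS.
have [bT|nbT] := classic (bad (S :\: H)); last first.
  (* The [k] edges of [H] and at least two leaving it pay for [h], which dominates [H]; copies
     avoiding [H] are left to induction. *)
  have [D le iD] := IH pT cT nbT; exists (h |: D).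
    have := leq_mul (card_set1U h D) (leqnn (k + 2)).
    by move: eS le a2; rewrite edH; clear; lia.
  move=> g cg; have [/existsP[a aH]|/existsPn nH] := boolP [exists a, g a \in H].
    apply: (@hitsS _ _ _ [set h]); first exact: subsetUl.
    by apply: (hits1 (a := a)); apply: hdom.
  apply: (@hitsS _ _ _ D); first exact: subsetUr.
  by apply: iD; apply: (copy_sub cg) => a; have [_ gS _] := cg; rewrite inE nH gS.
case: bT => [[cardT edT _]|/(no_C6 pT)//].
have ZE : Z = S :\: H.
  apply/eqP; rewrite eqEcard cardT (nb_card cf) leqnn andbT.
  by apply/subsetP => z zZ; rewrite inE (subsetP ZS) // andbT; apply/negP => /(subsetP HR); rewrite inE zZ.
(* With two joining edges, [ed S + 1] is [2k + 3], one short of the price of both centres; a third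
   edge makes up the difference. *)
have [e2|n2] := eqVneq (adjn H (S :\: H)) 2.
  have [|d iD] := two_copies cf HS ZE iF; first by rewrite -e2 -ZE.
  by exists [set d] => //; rewrite cards1 eS edH edT e2; clear; lia.
exists (v |: [set h]).
  have := leq_mul (card_set1U v [set h]) (leqnn (k + 2)); rewrite cards1.
  by move: eS a2 n2; rewrite edH edT; clear; lia.
move=> g cg; have [_ gS _] := cg; have [gZ|gZ] := boolP (g c0 \in Z); first exact: nb_hit.
apply: (@hitsS _ _ _ [set h]); first exact: subsetUr.
apply: (hits1 (a := c0)); apply: hdom.
by move: gZ; rewrite ZE inE gS andbT negbK.
Qed.

Lemma sparse_case f : copy S f -> solved S.
Proof.
move=> cf; set v := f c0; set Z := nb S v; set R := S :\: Z.
have [[H [cH iF]]|noF] := classic (exists H, component R H /\ is_F H).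
  exact: copy_component_case cf cH iF.
have [_ fS _] := cf; have vS : v \in S := fS c0.
have ZS : Z \subset S := nb_sub _ _.
have vZ : v \in Z := nb_v vS.
have Z0 : Z != set0 by apply/set0Pn; exists v.
have eZS : ed S = k + ed R + adjn R Z by rewrite (ed_split ZS) (ed_nbE cf) adjnC.
have pH H : component R H -> H \proper S := component_proper ZS Z0.
have goodD H : component R H ->
    exists2 D : {set G}, #|D| * (k + 2) <= ed H + 1 & isol H D.
  move=> cH; apply: IH; [exact: pH|by case: cH|case=> [iF|]].
    by apply: noF; exists H.
  exact: no_C6 (pH _ cH).
have nb_solved D : #|v |: D| * (k + 2) <= ed S + 1 -> cov S [set v] R D -> solved S.
  move=> le cD; exists (v |: D) => // g cg; have [_ gS _] := cg.
  have [cgZ|ncg] := boolP (g c0 \in Z); first exact: nb_hit.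
  by apply: cD; rewrite // inE ncg gS.
(* The edges of [Z] and the spare unit give [k + 1] of the price [k + 2] of [v]. A component
   supplies the missing unit if it has a second edge to [Z], or if [ed H + 1] is not a multiple of
   [k + 2] and so is not attained. *)
have [[H [cH sl]]|noslack] := classic (exists H, component R H /\
    ((adjn H Z != 1) || ~~ (k + 2 %| ed H + 1))).
  have [D1 le1 i1] := goodD H cH; have c1 := isol_cov_comp cH (nb_dom v) i1.
  have [H'|D2 le2 c2] := @cov_comps _ _ c0 k S [set v] Z (R :\: H).
    by move=> /(component_compl cH) cH'; apply: budget_comp => //; apply: nb_dom.
  apply: (@nb_solved (D1 :|: D2)); last first.
    move=> g cg gR; have [gH|gH] := boolP (g c0 \in H).
      by apply: hitsS (c1 g cg gH); apply/setUS/subsetUl.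
    by apply: hitsS (c2 g cg _); [apply/setUS/subsetUr|rewrite inE gH].
  have lt1 : #|D1| * (k + 2) + 1 <= ed H + adjn H Z.
    have := component_adjn_gt0 conn_S cH ZS Z0; case/orP: sl => [a1|nd] a0.
      by move: le1 a0 a1; clear; lia.
    suff : #|D1| * (k + 2) != ed H + 1 by move: le1 a0; clear; lia.
    by apply: contra nd => /eqP <-; apply: dvdn_mull.
  have [_ HR cl] := cH; have [leU _] := leq_card_setU D1 D2.
  have := leq_mul (leq_trans (card_set1U v (D1 :|: D2)) (leq_add (leqnn 1) leU)) (leqnn (k + 2)).
  by move: lt1 le2; rewrite eZS (ed_split HR) cl (adjn_split _ HR); clear; lia.
have tight H : component R H -> adjn H Z = 1 /\ (k + 2 %| ed H + 1).
  move=> cH; have [a1|a1] := eqVneq (adjn H Z) 1; last first.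
    by case: noslack; exists H; rewrite a1.
  split=> //; apply/negPn/negP => nd; apply: noslack; exists H.
  by rewrite nd orbT.
have R0 : R != set0.
  apply/eqP => e; have eS : S = Z by apply/eqP; rewrite eqEsubset ZS andbT -setD_eq0 -/R e.
  apply: good_S; left; split; [|by rewrite {1}eS (ed_nbE cf)|by exists f].
  by rewrite {1}eS (nb_card cf).
have [H1 cH1] := component_ex R0; have [a1 dv1] := tight H1 cH1.
have [cn1 H1R cl1] := cH1.
have /adjn_gt0P[y [x [yH xZ yx]]] : 0 < adjn H1 Z by rewrite a1.
have [xS yS] : x \in S /\ y \in S.
  by split; [apply: (subsetP ZS)|apply: (subsetP (subset_trans H1R (subsetDl _ _)))].
have xy : sadj x y by rewrite sadj_sym.
have sy : [set y] \subset H1 by rewrite sub1set.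
(* Since [x] dominates [y], [H1] is split further at [y]. The one edge from [H1] to [Z] starts at
   [y], so all edges of [S] leaving a component [A] of [H1 :\ y] end at [y]. *)
have [A cA|DA leA cvA] := @cov_comps _ _ c0 k S [set x] [set y] (H1 :\ y).
  have [cnA AH cl] := cA; have y0 : [set y] != set0 by apply/set0Pn; exists y; rewrite set11.
  have aA : adjn A (S :\: A) = adjn A [set y].
    have nAH1 : adjn A (S :\: H1) = 0.
      have AH1 := subset_trans AH (subsetDl _ _).
      apply/eqP; rewrite -leqn0 leqNgt; apply/negP => /adjn_gt0P[p [q [pA qS pq]]].
      move: qS; rewrite inE => /andP[qH qS].
      have pH1 := subsetP AH1 _ pA.
      have := component_nb cH1 pH1 qS pq; rewrite in_setU (negPf qH) /= => qZ.
      have [e _] := adjn_eq1 a1 yH xZ yx pH1 qZ pq.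
      by have := subsetP AH _ pA; rewrite e !inE eqxx.
    have sH1 : H1 :\: A \subset S :\: A.
      by apply/setSD/(subset_trans H1R)/subsetDl.
    have syA : [set y] \subset H1 :\: A.
      rewrite sub1set inE yH andbT; apply/negP => /(subsetP AH).
      by rewrite !inE eqxx.
    rewrite (adjn_splitr _ sH1) (adjn_splitr _ syA) setDDl setUC -setDDl cl addn0.
    suff -> : adjn A (S :\: A :\: (H1 :\: A)) = 0 by rewrite addn0.
    apply/eqP; rewrite -leqn0 -nAH1; apply: adjnSr; apply/subsetP => z.
    by rewrite !inE; case: (z \in A); case: (z \in H1).
  have AS : A \subset S.
    apply: subset_trans AH (subset_trans (subsetDl _ _) (proper_sub (pH _ cH1))).
  have pA : A \proper S.
    apply/properP; split=> //; exists y => //; apply/negP => /(subsetP AH).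
    by rewrite !inE eqxx.
  have [|bA|D le iD] := budget pA cnA (Z := [set y]).
  - exact: component_adjn_gt0 cn1 cA sy y0.
  - by rewrite -aA; apply: bad_adjn.
  - exists D => //; apply: (isol_cov c0_dom (Z := [set y])) iD.
      by rewrite sub1set nbh1 xy orbT.
    move=> u w uA wS uw; rewrite in_setU; apply/negPn/negP; rewrite negb_or => /andP[wA wy].
    have sb : [set y] \subset S :\: A.
      by rewrite sub1set inE yS andbT; apply/negP => /(subsetP AH); rewrite !inE eqxx.
    move: aA; rewrite (adjn_splitr _ sb) => aA.
    have a0 : adjn A (S :\: A :\: [set y]) = 0 by move: aA; clear; lia.
    by have := adjn_eq0 a0 uA (y := w); rewrite !in_setD wA wy wS uw => /(_ isT).
(* Adding to [H] its only neighbour [q] in [Z] is free: [k + 2] divides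
   [ed H + 1], so the bound for [q |: H] is the same. *)
have [H cH|DT leT cvT] := @cov_comps _ _ c0 k S [set x] Z (R :\: H1).
  have {cH} cH := component_compl cH1 cH; have [aH dvH] := tight H cH.
  have [cnH HR clH] := cH.
  have /adjn_gt0P[p [q [pH' qZ pq]]] : 0 < adjn H Z by rewrite aH.
  have qp : sadj q p by rewrite sadj_sym.
  have qS := subsetP ZS _ qZ.
  have HS := proper_sub (pH _ cH).
  have qH : q \notin H by apply/negP => /(subsetP HR); rewrite inE qZ.
  have eT : ed (q |: H) = ed H + 1.
    rewrite (ed_add1 qH); congr addn; apply/eqP; rewrite eqn_leq; apply/andP; split.
      by rewrite -aH; apply: adjnSr; rewrite sub1set.
    by apply/adjn_gt0P; exists p, q; rewrite set11.
  have pS := subsetP HS _ pH'.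
  have vq : v != q.
    apply/eqP => e; have : p \in Z by rewrite inE pS e qp orbT.
    by have := subsetP HR _ pH'; rewrite inE => /andP[/negPf->].
  have pT : q |: H \proper S.
    apply/properP; split; first by rewrite subUset sub1set qS.
    exists v => //; rewrite !inE negb_or vq /=; apply/negP => /(subsetP HR).
    by rewrite inE vZ.
  have [|D le iD] := IH pT (conn_add1 cnH pH' qp).
    (* A copy of [F] has only [k] edges, whereas [ed (q |: H)] is a positive multiple of [k + 2]. *)
    case=> [[_ e _]|]; last exact: no_C6 pT.
    have p0 : 0 < ed H + 1 by rewrite addn1.
    by have := dvdn_leq p0 dvH; rewrite -eT e; clear; lia.
  exists D.
    have [w ew] := dvdnP dvH; rewrite aH ew leq_mul2r; apply/orP; right.
    rewrite leqNgt; apply/negP => lt; have := leq_mul lt (leqnn (k + 2)).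
    by move: le; rewrite eT ew; clear; lia.
  move=> g cg gH; have [_ gS hom] := cg; apply: hitsS (iD g _); first exact: subsetUr.
  apply: (copy_sub cg) => a; rewrite in_setU1.
  have [->|nac] := eqVneq a c0; first by rewrite gH orbT.
  have ad := hom _ _ (c0_dom nac); have := component_nb cH gH (gS a) ad.
  rewrite in_setU => /orP[->|aZ]; first by rewrite orbT.
  by have [_ ->] := adjn_eq1 aH pH' qZ pq gH aZ ad; rewrite eqxx.
(* With [ed H1 + 1 = w * (k + 2)], the cover of [H1 :\ y] is paid by [ed H1] alone, so [#|DA| < w].
   Thus [x] and [DA] together cost at most [ed H1] plus the edge from [H1] to [Z]. *)
exists (x |: (DA :|: DT)).
  have [leU _] := leq_card_setU DA DT.
  have := leq_mul (leq_trans (card_set1U x (DA :|: DT)) (leq_add (leqnn 1) leU)) (leqnn (k + 2)).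
  have eH1 : ed H1 = ed (H1 :\ y) + adjn (H1 :\ y) [set y].
    by rewrite (ed_split sy) ed1 adjnC.
  have [w ew] := dvdnP dv1.
  have ltA : #|DA| < w.
    rewrite -(@ltn_pmul2r (k + 2)) ?addn2 // -addn2 -ew eH1.
    by apply: leq_ltn_trans leA _; rewrite addn1.
  have := leq_mul ltA (leqnn (k + 2)).
  by move: leT ew; rewrite eZS (ed_split H1R) cl1 (adjn_split _ H1R); clear; lia.
move=> g cg; have [_ gS _] := cg.
have hitx D : hits g [set x] -> hits g (x |: D) by apply: hitsS; apply: subsetUl.
have [gZ|gZ] := boolP (g c0 \in Z).
  (* A copy centred in [Z] is the whole closed neighbourhood of its centre, so it contains [v],
     which [x] dominates. *)
  apply: hitx; have : v \in nb S (g c0).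
    by move: gZ; rewrite !inE vS sadj_sym eq_sym => /andP[].
  rewrite (nb_img c0_dom ed_F cg (sparse cg)) => /imsetP[a _ e].
  apply: (hits1 (a := a)); rewrite -e.
  by move: xZ; rewrite inE sadj_sym eq_sym => /andP[].
have [gy|gy] := eqVneq (g c0) y.
  by apply: hitx; apply: (hits1 (a := c0)); rewrite gy xy orbT.
have [gH|gH] := boolP (g c0 \in H1).
  by apply: hitsS (cvA g cg _); [apply/setUS/subsetUl|rewrite !inE gy gH].
apply: hitsS (cvT g cg _); first by apply/setUS/subsetUr.
by rewrite !in_setD gH gZ gS.
Qed.

End Step.

Lemma solved_good (F G : sgraph) (c0 : F) (S : {set G}) :
  (forall a, a != c0 -> sadj c0 a) -> conn S -> ~ @bad F G (ed [set: F]) S ->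
  @solved F G (ed [set: F]) S.
Proof.
move=> dom; have [n] := ubnP #|S|; elim: n => // n IHn in S * => ltn cS gS.
have IH (T : {set G}) : T \proper S -> conn T -> ~ @bad F G (ed [set: F]) T ->
    @solved F G (ed [set: F]) T.
  by move=> pT; apply: IHn; apply: leq_trans (proper_card pT) _.
have [[f cf]|nf] := classic (exists f : F -> G, copy S f); last first.
  by exists set0; rewrite ?cards0 // => f cf; case: nf; exists f.
have [[x [H [xS cH bH a1]]]|nd] := classic (exists x (H : {set G}), [/\ x \in S,
    component (S :\ x) H, @bad F G (ed [set: F]) H & adjn H [set x] = 1]).
  exact: (deficit_case dom erefl cS IH xS cH bH a1).
have ND x (H : {set G}) : x \in S -> component (S :\ x) H -> @bad F G (ed [set: F]) H ->
    adjn H [set x] != 1.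
  by move=> xS cH bH; apply/eqP => a1; apply: nd; exists x, H.
have [[g [cg lt]]|ns] := classic (exists g : F -> G,
    copy S g /\ ed [set: F] < ed (nb S (g c0))).
  exact: (dense_case dom erefl cS IH ND cg lt).
apply: (sparse_case dom erefl cS gS IH ND _ cf) => g cg.
by rewrite leqNgt; apply/negP => lt; apply: ns; exists g.
Qed.

(** * The bound and its sharpness *)

(** Each edge is the image of exactly two ordered pairs. *)
Lemma nedges_ed (G : sgraph) : nedges G = ed [set: G].
Proof.
apply: double_inj; rewrite -adjn_even /adjn sum_setT.
under [RHS]eq_bigr => x _ do rewrite sum_setT.
rewrite pair_big /= -[RHS]big_mkcond /=.
rewrite (partition_big_imset (fun p : G * G => [set p.1; p.2])) /=.
rewrite -muln2 /nedges /nedges_rel /edges_rel -sum_nat_const.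
apply: eq_bigr => E /imsetP[[x y] /= xy ->]; rewrite inE /= in xy.
rewrite sum1_card; apply/esym.
have nxy : (x, y) != (y, x).
  by apply/eqP => -[e _]; rewrite e sadj_irr in xy.
have <- : #|[set (x, y); (y, x)]| = 2 by rewrite cards2 nxy.
apply: eq_card => -[a b]; rewrite !inE /= !xpair_eqE.
apply/andP/orP => [[ab /eqP e]|[]/andP[/eqP-> /eqP->]]; first 1 last.
- by split; first exact: xy.
- by split; [rewrite -topredE /= sadj_sym|rewrite setUC].
have {}ab : sadj a b := ab; have := set21 a b; have := set22 a b; rewrite e !inE.
by case/orP=> /eqP eb /orP[]/eqP ea; rewrite ea eb ?sadj_irr // in ab *;
  rewrite !eqxx; [right|left].
Qed.

Lemma connected_conn (G : sgraph) : connected G -> conn [set: G].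
Proof.
case=> G0 cG; split=> // A _ A0 AnT; rewrite lt0n; apply/negP => /eqP c0.
have /set0Pn[x xA] := A0.
have /subsetPn[y _ yA] : ~~ ([set: G] \subset A).
  by apply: contra AnT => h; rewrite eqEsubset subsetT.
have cl : closed (@sadj G) A.
  move=> u w uw; apply/idP/idP => [uA|wA]; apply/negPn/negP => n.
    by have := adjn_eq0 c0 uA (y := w); rewrite uw !inE n => /(_ isT).
  by have := adjn_eq0 c0 wA (y := u); rewrite sadj_sym uw !inE n => /(_ isT).
have := closed_connect cl (cG x y (in_setT x) (in_setT y)).
by rewrite xA (negPf yA).
Qed.

(** * Minima with a default value *)

Section BigMin.
Context {I : finType} (P : pred I) (E : I -> nat) (x0 : nat).

Lemma bigminn_le i : P i -> \big[minn/x0]_(i | P i) E i <= E i.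
Proof.
move=> Pi; have := mem_index_enum i; elim: (index_enum I) => // j r IH.
rewrite big_cons inE => /orP[/eqP<-|/IH le]; first by rewrite Pi geq_minl.
by case: ifP => // _; apply: leq_trans (geq_minr _ _) le.
Qed.

Lemma bigminn_ge n : n <= x0 -> (forall i, P i -> n <= E i) ->
  n <= \big[minn/x0]_(i | P i) E i.
Proof. by move=> nx nE; elim/big_ind: _ => // a b na nb; rewrite leq_min na. Qed.

Lemma bigminn_ex : \big[minn/x0]_(i | P i) E i = x0 \/
  exists2 i, P i & \big[minn/x0]_(i | P i) E i = E i.
Proof.
apply: (big_ind (fun n => n = x0 \/ exists2 i, P i & n = E i)) => [|a b ha hb|i Pi];
  [by left| |by right; exists i].
by rewrite /minn; case: ifP.
Qed.

End BigMin.

(** * Translation between the working notions and the stated ones *)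

Lemma gamma1_center (F : sgraph) : gamma F = 1 ->
  exists c0 : F, forall a, a != c0 -> sadj c0 a.
Proof.
move=> g1; have [] := @bigminn_ex _ (fun D : {set F} => dominating D) (fun D => #|D|) #|F|.
  (* If the minimum is the default value [#|F|], then [F] has a single vertex. *)
  rewrite -/(gamma F) g1 => /esym/eqP/fintype1P[c0 h].
  by exists c0 => a; rewrite (h a) eqxx.
rewrite -/(gamma F) g1 => -[D dD /esym/eqP/cards1P[c0 eD]]; exists c0 => a ac.
move/eqP: dD => dD; have := in_setT a; rewrite -dD inE eD inE (negPf ac) /=.
by case/exists_inP => y; rewrite inE => /eqP->.
Qed.

(** A bijective homomorphism between graphs with equally many edges reflects adjacency: termwise
    inequalities with equal sums are equalities. *)
Lemma is_F_iso (F G : sgraph) (c0 : F) : (forall a, a != c0 -> sadj c0 a) ->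
  @is_F F G (ed [set: F]) [set: G] -> iso G F.
Proof.
move=> dom iF; have [cG eG [f cf]] := iF; have [inj _ hom] := cf.
rewrite !cardsT in cG.
have [g fK gK] : bijective f by apply: inj_card_bij; rewrite // cG.
exists g; split; first by exists f.
suff adj a b : sadj (f a) (f b) = sadj a b by move=> x y; rewrite -adj !gK.
have := adjn_img cf; rewrite -(is_F_img dom iF cf) adjn_even eG -adjn_even adjn_T.
rewrite !pair_big /= => e.
pose E1 (p : F * F) : nat := sadj p.1 p.2; pose E2 (p : F * F) : nat := sadj (f p.1) (f p.2).
have le p : xpredT p -> E1 p <= E2 p ?= iff (E1 p == E2 p).
  by move=> _; split=> //; rewrite /E1 /E2; case: (boolP (sadj p.1 p.2)) => // /hom->.
have [_] := leqif_sum le; rewrite {1}/E1 {1}/E2 e eqxx => /esym/forallP/(_ (a, b)) /=.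
by rewrite /E1 /E2 /=; case: (sadj a b); case: (sadj (f a) (f b)).
Qed.

Lemma is_C6_iso (F G : sgraph) (c0 : F) : (forall a, a != c0 -> sadj c0 a) ->
  @is_C6 F G (ed [set: F]) [set: G] ->
  iso_rel (@sadj F) P3rel /\ iso_rel (@sadj G) C6rel.
Proof.
move=> dom [F3 k2 [h [inj eT adj]]]; split.
  have [[a [b [nab eab]]] adjF] := star3 dom erefl F3 k2.
  pose g (p : F) : 'I_3 := if p == c0 then inord 1 else if p == a then ord0 else ord_max.
  have sp (p : F) : p != c0 -> (p == a) || (p == b).
    by move=> pc; rewrite -in_set2 -eab !inE pc.
  exists g; split=> [|p q].
    apply: inj_card_bij; last by rewrite F3 card_ord.
    move=> p q; rewrite /g.
    have [->|pc] := eqVneq p c0; have [->|qc] := eqVneq q c0 => //.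
    - by case: ifP => _ /(congr1 val) /=; rewrite inordK.
    - by case: ifP => _ /(congr1 val) /=; rewrite inordK.
    have := sp _ pc; have := sp _ qc.
    have [->|_] := eqVneq p a; have [->|_] := eqVneq q a => //=.
    by move=> /eqP-> /eqP->.
  have g1 r : (val (g r) == 1) = (r == c0).
    by rewrite /g; case: (r == c0); [rewrite /= inordK|case: ifP].
  by rewrite /P3rel !g1 adjF.
have cG : #|G| = 6 by rewrite -cardsT eT card_imset // cardsT card_ord.
have [g hK gK] : bijective h by apply: inj_card_bij; rewrite // cG card_ord.
by exists g; split=> [|x y]; [exists h|rewrite -adj !gK].
Qed.

Lemma isol_isolating (F G : sgraph) (D : {set G}) :
  @isol F G [set: G] D -> F_isolating F D.
Proof.
move=> iD; apply/negP => /existsP[f /and3P[/injectiveP inj /forallP out /forallP hom]].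
have [|a] := iD f; last by rewrite (negPf (out a)).
by split=> // a b; have /forallP/(_ b)/implyP := hom a.
Qed.

(** A vertex of [D] that dominates a vertex of the $i$-th copy lies in that copy or is [v i]. The
    [q] sets $V(G_i)$ are disjoint, and each must contain a vertex of [D]. *)
Lemma special_lower (F G : sgraph) (m : nat) :
  special m F G -> (m + 1) %/ (nedges F + 2) <= iotaF G F.
Proof.
rewrite /special addn1; set q := _ %/ _; case: eqP => [->//|_].
case=> v [phi [w [t [W [t' [[vI pI vp pp] _ [_ _ tW _ _] [Wv _] adj]]]]]].
pose inG x i := x = v i \/ exists a, x = phi i a.
have inG_inj x i j : inG x i -> inG x j -> i = j.
  move=> [->|[a ->]] [e|[b e]].
  - exact: vI.
  - by case: (vp i j b).
  - by case: (vp j i a).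
  - by apply/eqP/negPn/negP => /eqP ne; case: (pp i j a b ne).
apply: bigminn_ge => [|D iD].
  (* The default value [#|G|] is at least [q] because the [v i] are distinct. *)
  by rewrite -[q]card_ord; apply: leq_card vI.
have ex i : exists d, d \in D /\ inG d i.
  apply: NNPP => no; move/negP: iD; apply; apply/existsP.
  exists [ffun a => phi i a]; apply/and3P; split.
  - by apply/injectiveP => a b; rewrite !ffunE; apply: pI.
  - apply/forallP => a; rewrite ffunE; apply/negP; rewrite inE => /orP[aD|].
      by apply: no; exists (phi i a); split=> //; right; exists a.
    case/exists_inP => y yD /adj[[j [j' [_ _ e]]]|ty|[j [[ey e]|[_ e]]]|[j [b [b' [_ ey e]]]]].
    + by case: (vp j' i a).
    (* An edge of $T'$ cannot reach a copy, as $T'$ meets the sets $V(G_i)$ only in $v_q$. *)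
    + have [_ pW] := tW _ _ ty.
      have [|j [_ e]] := (Wv (phi i a)).1; last by case: (vp j i a).
      by split=> //; exists i; right; exists a.
    + have ij : i = j by apply: (inG_inj (phi i a)); right; [exists a|exists (w j)].
      by apply: no; exists y; split=> //; left; rewrite ij.
    + by case: (vp j i a).
    + have ij : i = j by apply: (inG_inj (phi i a)); right; [exists a|exists b'].
      by apply: no; exists y; split=> //; right; exists b; rewrite ij.
  - apply/forallP => a; apply/forallP => b; apply/implyP => ab; rewrite !ffunE.
    by apply/adj; apply: Or44; exists i, a, b.
have [d hd] := fin_all_exists ex.
have dI : injective d.
  by move=> i j e; apply: (inG_inj (d i)); [case: (hd i)|rewrite e; case: (hd j)].
rewrite -[q]card_ord -(card_imset _ dI); apply: subset_leq_card.
by apply/subsetP => x /imsetP[i _ ->]; case: (hd i).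
Qed.

Theorem theorem1p2 (F G : sgraph) (k m : nat) :
  nedges F = k -> gamma F = 1 ->
  nedges G = m -> connected G ->
  ~ iso G F ->
  ~ (iso_rel (@sadj F) P3rel /\ iso_rel (@sadj G) C6rel) ->
  iotaF G F <= (m + 1) %/ (k + 2) /\
  (special m F G -> iotaF G F = (m + 1) %/ (k + 2)).
Proof.
move=> <- g1 <- cG nF nC; have [c0 dom] := gamma1_center g1.
suff le : iotaF G F <= (nedges G + 1) %/ (nedges F + 2).
  by split=> // /special_lower ge; apply/eqP; rewrite eqn_leq le.
have [|D leD iD] := solved_good dom (connected_conn cG).
  by case=> [/(is_F_iso dom)//|/(is_C6_iso dom)].
apply: leq_trans (bigminn_le _ _ (isol_isolating iD)) _.
by rewrite leq_divRL ?addn2 // -addn2 !nedges_ed.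
Qed.
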